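(* Let $(X,T)$ be a topological dynamical system. If $(X,T)$ is mean proximal, then $(X,T)$ has no mean Li-Yorke pairs.
   Context: A topological dynamical system (TDS) is a pair $(X,T)$ where $X$ is a compact metric space with metric $d$ and $T:X\to X$ is continuous ($T$ is not assumed invertible). A pair $(x,y)\in X\times X$ is mean proximal if $\liminf_{n\to\infty}\frac1n\sum_{i=0}^{n-1}d(T^i x,T^i y)=0$. The system $(X,T)$ is mean proximal if every pair $(x,y)\in X\times X$ is mean proximal. A pair $(x,y)\in X\times X$ is a mean Li-Yorke pair if it is mean proximal and $\limsup_{n\to\infty}\frac1n\sum_{i=0}^{n-1}d(T^i x,T^i y)>0$. *)

(* Defs.v *)
From HB Require Import structures.
From mathcomp Require Import all_boot all_order all_algebra.
From mathcomp Require Import all_classical all_reals all_analysis.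

Set Implicit Arguments.
Unset Strict Implicit.
Unset Printing Implicit Defensive.

Import Order.TTheory GRing.Theory Num.Theory.
Import numFieldNormedType.Exports.

Local Open Scope classical_set_scope.
Local Open Scope ring_scope.

Definition topological_dynamical_system (R : realType) (X : metricType R)
    (T : X -> X) : Prop :=
  compact [set: X] /\ continuous T.

(* The term n = 0 is 0 (as 0^-1 = 0); it does not affect the limits below. *)
Definition mean_dist (R : realType) (X : metricType R) (T : X -> X) (x y : X)
    (n : nat) : R :=
  n%:R^-1 * \sum_(i < n) mdist (iter i T x) (iter i T y).

(* The limits are taken in \bar R, where liminf and limsup always exist. *)
Definition mean_proximal_pair (R : realType) (X : metricType R) (T : X -> X)
    (x y : X) : Prop :=
  limn_einf (fun n => (mean_dist T x y n)%:E) = 0%E.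

Definition mean_proximal (R : realType) (X : metricType R) (T : X -> X) : Prop :=
  forall x y : X, mean_proximal_pair T x y.

Definition mean_Li_Yorke_pair (R : realType) (X : metricType R) (T : X -> X)
    (x y : X) : Prop :=
  mean_proximal_pair T x y /\
  (0 < limn_esup (fun n => (mean_dist T x y n)%:E))%E.

(* Main.v *)
Require Import Defs.
From mathcomp Require Import all_boot all_order all_algebra.
From mathcomp Require Import all_classical all_reals all_analysis.
From mathcomp Require Import lra.

Set Implicit Arguments.
Unset Strict Implicit.
Unset Printing Implicit Defensive.

Import Order.TTheory GRing.Theory Num.Theory.
Import numFieldNormedType.Exports.

Local Open Scope classical_set_scope.
Local Open Scope ring_scope.

(** Mean proximality of every pair forces the mean distance of every pair to
tend to 0, so that its limsup cannot be positive.  The point is that a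
pointwise liminf condition becomes uniform on a compact space.

Consider the map [g = T * T] on the compact space [X * X] and the continuous
function [f = d], and fix [e > 0].  Every point [p] has, by the liminf
hypothesis, a time [k > 0] at which the Birkhoff sum satisfies
[S_k f p < e k].  This strict inequality is open in [p], so compactness bounds
these times by a single [N] ([birkhoff_sum_sublinear]).  Any orbit segment can
now be chopped greedily into pieces of length at most [N], each with average at
most [e], plus a last piece, also of length at most [N], which contributes at most
[N * sup f].  Hence [S_n f <= e n + N * sup f] ([birkhoff_sum_chop]), and after
division by [n] the second term vanishes in the limit ([mean_dist_cvg0]).  This
replaces the usual detour through ergodic measures on [X * X]. *)

Definition birkhoff_sum (R : realType) (Y : Type) (g : Y -> Y) (f : Y -> R)
    (n : nat) (y : Y) : R :=
  \sum_(i < n) f (iter i g y).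

Lemma birkhoff_sumD (R : realType) (Y : Type) (g : Y -> Y) (f : Y -> R)
    (k n : nat) (y : Y) :
  birkhoff_sum g f (k + n) y =
  birkhoff_sum g f k y + birkhoff_sum g f n (iter k g y).
Proof.
rewrite /birkhoff_sum big_split_ord /=; congr (_ + _).
by apply: eq_bigr => i _; rewrite addnC iterD.
Qed.

(** Induction on [n]: as long as [n] exceeds [N], the good time of the current
point is a proper initial piece of the segment, and the rest of the segment
starts at another point of the space, to which the hypothesis applies again. *)
Lemma birkhoff_sum_chop (R : realType) (Y : Type) (g : Y -> Y) (f : Y -> R)
    (N : nat) (e M : R) (e0 : 0 <= e) (M0 : 0 <= M)
    (fM : forall y, f y <= M)
    (small : forall y, exists2 k : nat,
       (0 < k <= N)%N & birkhoff_sum g f k y <= e * k%:R) (n : nat) (y : Y) :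
  birkhoff_sum g f n y <= e * n%:R + N%:R * M.
Proof.
elim/ltn_ind: n y => n IHn y.
have [nN|Nn] := leqP n N.
  apply: (@le_trans _ _ (n%:R * M)).
    rewrite mulr_natl -[n in leRHS]card_ord -sumr_const.
    exact: ler_sum.
  by rewrite -[leLHS]add0r lerD ?mulr_ge0 ?ler_wpM2r ?ler_nat.
have [k /andP[k0 kN] ky] := small y.
have kn : (k <= n)%N := ltnW (leq_ltn_trans kN Nn).
rewrite -(subnKC kn) birkhoff_sumD natrD mulrDr -addrA lerD //.
by rewrite IHn // ltn_subrL k0 (leq_trans k0 kn).
Qed.

Lemma continuous_iter (Y : topologicalType) (g : Y -> Y) (n : nat) :
  continuous g -> continuous (iter n g).
Proof.
move=> cg; elim: n => [|n IHn] y; first exact: cvg_id.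
apply: continuous_comp; [exact: IHn | exact: cg].
Qed.

Lemma continuous_birkhoff_sum (R : realType) (Y : topologicalType)
    (g : Y -> Y) (f : Y -> R) (n : nat) :
  continuous g -> continuous f -> continuous (birkhoff_sum g f n).
Proof.
move=> cg cf; apply: continuous_big; first exact: add_continuous.
by move=> i _ y; apply: continuous_comp; [exact: continuous_iter | exact: cf].
Qed.

(** The good times, which a priori depend on the point, are locally bounded
because the strict inequality persists nearby; compactness makes the bound
global and the orbits can be chopped. *)
Lemma birkhoff_sum_sublinear (R : realType) (Y : topologicalType)
    (g : Y -> Y) (f : Y -> R) (e : R) (cptY : compact [set: Y])
    (cg : continuous g) (cf : continuous f) (e0 : 0 <= e)
    (small : forall y, exists2 k : nat,
       (0 < k)%N & birkhoff_sum g f k y < e * k%:R) :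
  exists C : R, forall n y, birkhoff_sum g f n y <= e * n%:R + C.
Proof.
have cover := cptY; move/compact_near_coveringP in cover.
have [N _ unifN] : \forall N \near \oo, [set: Y] `<=` [set y | exists2 k : nat,
    (0 < k <= N)%N & birkhoff_sum g f k y <= e * k%:R].
  apply: cover => y _; have [k k0 ky] := small y.
  have cS : continuous (birkhoff_sum g f k) := continuous_birkhoff_sum cg cf.
  exists ([set z | birkhoff_sum g f k z < e * k%:R], [set N | (k <= N)%N]).
    by split; [exact: cvgr_lt (cS y) _ ky | exists k].
  by move=> [z N] /= [zk kN]; exists k; rewrite ?k0 ?ltW.
have [M [M0 fM]] : exists M : R, 0 <= M /\ forall y, f y <= M.
  have fM : \forall M \near +oo, [set: Y] `<=` [set y | f y <= M].
    apply: cover => y _.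
    have ltf1 : f y < f y + 1 by rewrite ltrDl.
    exists ([set z | f z < f y + 1], [set M | f y + 1 <= M]).
      by split; [exact: cvgr_lt (cf y) _ ltf1 | exact: nbhs_pinfty_ge (num_real _)].
    by move=> [z M] /= [/ltW fz /(le_trans fz)].
  have M0 : \forall M \near +oo, 0 <= M :> R.
    exact: nbhs_pinfty_ge (num_real 0).
  have [M [M0' fM']] := filter_ex (filterI M0 fM).
  by exists M; split=> // y; exact: fM'.
exists (N%:R * M) => n y; apply: birkhoff_sum_chop => // z.
exact: (unifN N (leqnn N)).
Qed.

Lemma continuous_mdist (R : realType) (X : metricType R) :
  continuous (fun p : X * X => mdist p.1 p.2).
Proof.
move=> [x y]; apply/cvgrPdist_lt => e e0 /=.
have e20 : 0 < e / 2 by rewrite divr_gt0.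
exists (ball x (e / 2), ball y (e / 2)).
  by split; exact: nbhsx_ballx.
move=> [x' y'] /= []; rewrite !ballEmdist /= => xx' yy'.
have := metric_triangle x' x y'; have := metric_triangle x y y'.
have := metric_triangle x x' y; have := metric_triangle x' y' y.
rewrite (metric_sym x' x) (metric_sym y' y) => *.
by rewrite ltr_norml; apply/andP; split; lra.
Qed.

(** The index has to be positive to serve as the length of a piece of orbit;
this is why the tail from 1 on is used, whose infimum is below the liminf. *)
Lemma limn_einf0_exists_small (R : realType) (u : R ^nat) (e : R) :
  limn_einf (EFin \o u) = 0%E -> 0 < e -> exists2 k : nat, (0 < k)%N & u k < e.
Proof.
move=> u0 e0; have : (einfs (EFin \o u) 1%N <= 0)%E.
  rewrite -u0 limn_einf_lim; apply: lime_ge; first exact: is_cvg_einfs.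
  by exists 1%N => // n /= n1; exact: nondecreasing_einfs.
move=> /le_lt_trans - /(_ e%:E); rewrite lte_fin => /(_ e0) /ereal_inf_lt.
by move=> [_ [k /= k0 <-]]; rewrite lte_fin; exists k.
Qed.

(** The chopping bound is used with slope [e / 2], so that the constant [C] may
be absorbed in the remaining [e / 2 * n] for large [n]. *)
Lemma mean_dist_cvg0 (R : realType) (X : metricType R) (T : X -> X) (x y : X) :
  topological_dynamical_system T -> mean_proximal T ->
  mean_dist T x y n @[n --> \oo] --> 0.
Proof.
move=> [cptX cT] mpT; pose g (p : X * X) := (T p.1, T p.2).
pose f (p : X * X) := mdist p.1 p.2.
have iterg n (p : X * X) : iter n g p = (iter n T p.1, iter n T p.2).
  by elim: n => [|n /= ->]; [case: p | ].
have meanE n p : mean_dist T p.1 p.2 n = n%:R^-1 * birkhoff_sum g f n p.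
  by congr (_ * _); apply: eq_bigr => i _; rewrite iterg.
have cptXX : compact [set: X * X] by rewrite -setXTT; exact: compact_setX.
have cg : continuous g.
  move=> p; apply: cvg_pair.
    exact: (continuous_comp cvg_fst (cT _)).
  exact: (continuous_comp cvg_snd (cT _)).
apply/cvgrPdist_lt => e e0; have e20 : 0 < e / 2 by rewrite divr_gt0.
have small p : exists2 k : nat,
    (0 < k)%N & birkhoff_sum g f k p < e / 2 * k%:R.
  have [k k0] := limn_einf0_exists_small (mpT p.1 p.2) e20.
  by rewrite meanE mulrC ltr_pdivrMr ?ltr0n //; exists k.
have [C leC] := birkhoff_sum_sublinear cptXX cg (@continuous_mdist R X)
  (ltW e20) small.
have Clim : \forall n \near \oo, C < e / 2 * n%:R.
  near=> n; rewrite -ltr_pdivrMl //; near: n; exact: nbhs_infty_gtr.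
near=> n.
have n0 : 0 < n%:R :> R by rewrite ltr0n; near: n; exact: nbhs_infty_gt.
rewrite sub0r normrN ger0_norm; last first.
  apply: mulr_ge0; first by rewrite invr_ge0 ltW.
  by apply: sumr_ge0 => i _; exact: mdist_ge0.
rewrite (meanE n (x, y)) mulrC ltr_pdivrMr //.
have Cn : C < e / 2 * n%:R by near: n.
apply: le_lt_trans (leC n (x, y)) _; by rewrite [e in ltRHS]splitr mulrDl ltrD2l.
Unshelve. all: by end_near. Qed.

Theorem corollary1p1 (R : realType) (X : metricType R) (T : X -> X)
    (tdsT : topological_dynamical_system T) (mpT : mean_proximal T) :
  ~ exists x y : X, mean_Li_Yorke_pair T x y.
Proof.
move=> [x [y [_]]].
have cvg0 : (mean_dist T x y n)%:E @[n --> \oo] --> 0%:E.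
  by apply: cvg_EFin; [exact: nearW | exact: mean_dist_cvg0].
by rewrite (cvg_limn_einf_sup cvg0).2 ltxx.
Qed.
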